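(* Let $G$ be a complete geometric graph with $n\geq 3$ vertices (in general position in the plane) such that exactly one vertex of $G$ does not lie on the boundary of the convex hull of $V(G)$. If $c$ is a colouring of the edges of $G$ using exactly $\binom{n}{2}-n+1$ colours, then $G$ has a heterochromatic plane spanning tree.
   Context: The complete geometric graph on a set $P$ of points in general position in the plane is the graph with vertex set $P$ whose edges are all straight line segments joining two points of $P$. A plane spanning tree is a spanning tree whose edges (as segments) pairwise do not cross. A subgraph is heterochromatic under an edge colouring if its edges receive pairwise distinct colours. *)

(* Defs.v *)
From mathcomp Require Import all_boot all_order all_algebra.
From mathcomp Require Import all_classical all_reals all_analysis.

Set Implicit Arguments.
Unset Strict Implicit.
Unset Printing Implicit Defensive.

Import Order.TTheory GRing.Theory Num.Theory.
Import numFieldNormedType.Exports.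

Local Open Scope ring_scope.

Section Graphs.
Variable V : finType.
Implicit Types E T : {set {set V}}.

(* A graph on V is given by its edge set, an edge being a two-element set. *)
Definition complete_edges : {set {set V}} := [set e : {set V} | #|e| == 2]%SET.

Definition adjacent E : rel V :=
  fun i j => (i != j) && ([set i; j]%SET \in E).

Definition connected_graph E := forall i j : V, connect (adjacent E) i j.

Definition acyclic_graph E :=
  forall s : seq V, (2 < size s)%N -> uniq s -> ~~ cycle (adjacent E) s.

Definition spanning_tree T :=
  [/\ T \subset complete_edges, connected_graph T & acyclic_graph T].

Definition heterochromatic (C : Type) (c : {set V} -> C) T :=
  {in T &, injective c}.

End Graphs.

Section Plane.
Variable R : realType.
Local Notation plane := 'rV[R]_2.
Local Open Scope classical_set_scope.

Definition convex_hull (A : set plane) : set plane :=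
  smallest (@convex_set R plane) A.

Definition boundary (A : set plane) : set plane := closure A `\` interior A.

Definition collinear (x y z : plane) :=
  exists o d : plane, d != 0 /\
    forall u, [set x; y; z] u -> exists t : R, u = o + t *: d.

(* The vertices of a complete geometric graph are the points p i, i : V. *)
Variables (V : finType) (p : V -> plane).

Definition general_position :=
  injective p /\
  forall i j k, i != j -> i != k -> j != k -> ~ collinear (p i) (p j) (p k).

(* The straight segment drawn for the edge e, without its two endpoints. *)
Definition open_edge (e : {set V}) : set plane :=
  [set x | exists i j (t : R), [/\ e = [set i; j]%SET, 0 < t, t < 1 &
                                 x = (1 - t) *: p i + t *: p j]].

(* In general position two distinct edges meet, apart from a common endpoint,
   only at points that are interior to both segments. *)
Definition edges_cross (e f : {set V}) :=
  e != f /\ open_edge e `&` open_edge f !=set0.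

Definition plane_graph (T : {set {set V}}) :=
  {in T &, forall e f, ~ edges_cross e f}.

End Plane.

(* Main.v *)
(** Let [m = n - 1].  Choosing one edge of each colour leaves a set [F] of exactly
    [m] edges, and it is enough to find, for some choice, a plane connected
    spanning graph in the complement of [F].  Suppose there is none.  Any set of
    points can be spanned when the number of missing edges is at most the number
    of points minus two: sort the points by a generic linear functional and glue
    two smaller instances at a point, unless the missing edges leave a complete
    bipartite graph between two separated halves.  Applied to the points other
    than a hull vertex [x], this shows that when exactly one hull edge at [x] is
    in [F], it is the only edge of [F] at [x].  Stars show that [F] covers every
    vertex.

    Now exchange in [F] an edge for the chosen edge of the same colour.  If [F]
    meets the hull cycle in a maximal path with at least two edges missing from
    the cycle, exchanging the end edge of this path shortens it, until it is a
    single edge isolated in [F], which is impossible.  So every [F] misses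
    exactly one hull edge, and exchanges rotate this gap around the hull until it
    reaches the hull vertex that [F] joins to the interior point; there [F] has
    two edges at a vertex where it may only have one. *)
Require Import Defs.
From mathcomp Require Import all_boot all_order all_algebra.
From mathcomp Require Import all_classical all_reals all_analysis.
From mathcomp Require Import ring lra zify.
(* Restores the finite-set and graph names shadowed by mathcomp-analysis. *)
From mathcomp Require Import finset.
Import Defs.

Set Implicit Arguments.
Unset Strict Implicit.
Unset Printing Implicit Defensive.

Import Order.TTheory GRing.Theory Num.Theory.
Import numFieldNormedType.Exports.

Local Open Scope ring_scope.

(** * Graphs and crossings *)

Section Graphs.
Variable V : finType.
Implicit Types (E T : {set {set V}}) (e : {set V}).

Lemma edge_set2 (a b : V) : a != b -> [set a; b]%SET \in complete_edges V.
Proof. by move=> ab; rewrite inE cards2 ab. Qed.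

Lemma edge_other e a : e \in complete_edges V -> a \in e ->
  exists2 b, a != b & e = [set a; b]%SET.
Proof.
rewrite inE => /cards2P[x [y [xy ->]]]; rewrite !inE => /orP[]/eqP->.
  by exists y.
by exists x; [rewrite eq_sym | rewrite finset.setUC].
Qed.

Lemma set2_inj (a b b' : V) : a != b -> [set a; b]%SET = [set a; b']%SET -> b = b'.
Proof.
move=> ab /setP/(_ b); rewrite !inE eqxx orbT eq_sym (negbTE ab) /=.
by move=> /esym/eqP.
Qed.

Lemma adjacent_sym E : symmetric (adjacent E).
Proof. by move=> i j; rewrite /adjacent eq_sym finset.setUC. Qed.

Lemma connect_adjC E : connect_sym (adjacent E).
Proof. exact/sym_connect_sym/adjacent_sym. Qed.

Lemma connect_edge E a b : [set a; b]%SET \in E -> connect (adjacent E) a b.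
Proof.
have [-> //|ab abE] := eqVneq a b.
by apply: connect1; rewrite /adjacent ab.
Qed.

Lemma connect_adjS E T : E \subset T ->
  subrel (connect (adjacent E)) (connect (adjacent T)).
Proof.
move=> ET; apply: connect_sub => i j /andP[_ /(fintype.subsetP ET)].
exact: connect_edge.
Qed.

(** A path that avoids [y] uses no edge at [y]. *)
Lemma path_adjD1 E (y z a : V) s : y \notin a :: s ->
  path (adjacent E) a s -> path (adjacent (E :\ [set y; z]%SET)) a s.
Proof.
elim: s a => //= b s IH a; rewrite !inE !negb_or => /and3P[ya yb ys].
move=> /andP[/andP[ab abE] bs].
rewrite IH ?inE ?negb_or ?yb // andbT /adjacent ab !inE abE andbT.
apply/negP => /eqP/setP/(_ y); rewrite !inE eqxx /=.
by rewrite (negbTE ya) (negbTE yb).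
Qed.

(** An inclusion-minimal connected subgraph is acyclic: an edge of a cycle could be deleted, since
    the rest of the cycle still joins its endpoints. *)
Lemma connected_spanning_tree E : E \subset complete_edges V ->
  connected_graph E -> exists2 T : {set {set V}}, T \subset E & spanning_tree T.
Proof.
move=> EK Ec; pose P T := [forall i, forall j, connect (adjacent T) i j].
have PP T : reflect (connected_graph T) (P T).
  apply: (iffP forallP) => h i; first by move=> j; exact: (forallP (h i)).
  exact/forallP.
have /minset_exists[T /minsetP[/PP Tc Tmin] TE] : P E by exact/PP.
exists T => //; split=> //; first exact: fintype.subset_trans TE EK.
move=> s; case: s => [|x [|y [|z s]]] //= _.
rewrite !inE !negb_or => /andP[/and3P[xy xz xs] /andP[/andP[yz ys] _]].
apply/negP => /and3P[/andP[_ xyT] /andP[_ yzT] zsx].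
have xNz : [set y; z]%SET != [set y; x]%SET.
  by apply/negP => /eqP /set2_inj e; rewrite e ?eqxx // in xz.
suff : P (T :\ [set y; x]%SET).
  move=> /Tmin/(_ (subD1set _ _)) /setP/(_ [set y; x]%SET).
  by rewrite !inE eqxx [X in X \in _]finset.setUC xyT.
have yx : connect (adjacent (T :\ [set y; x]%SET)) y x.
  apply: (connect_trans (y := z)).
    by apply: connect_edge; rewrite !inE xNz.
  apply/connectP; exists (rcons s x); last by rewrite last_rcons.
  by apply: path_adjD1 => //; rewrite inE mem_rcons inE !negb_or yz eq_sym xy.
apply/PP => i j; apply: (connect_sub _ (Tc i j)) => {i j} i j /andP[ij ijT].
have [ije|ijN] := eqVneq [set i; j]%SET [set y; x]%SET; last first.
  by apply: connect_edge; rewrite !inE ijN.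
have : i \in [set y; x]%SET by rewrite -ije !inE eqxx.
rewrite !inE => /orP[]/eqP ie; subst i; first by rewrite -(set2_inj _ (esym ije)) // eq_sym.
by rewrite connect_adjC; move: ije; rewrite [RHS]finset.setUC => /(set2_inj ij) ->.
Qed.

End Graphs.

(** * Orientations, separation of segments, and plane connected graphs *)

Section Geometry.
Variables (R : realType) (V : finType) (p : V -> 'rV[R]_2).
Hypothesis gp : general_position p.
Implicit Types (e f : {set V}) (S T F : {set {set V}}) (A B : {set V}).

(** Twice the signed area of the triangle [a b c], positive when it is counterclockwise. *)
Definition orient (a b c : 'rV[R]_2) : R :=
  (b 0 0 - a 0 0) * (c 0 1 - a 0 1) - (c 0 0 - a 0 0) * (b 0 1 - a 0 1).

Definition affine_form (phi : 'rV[R]_2 -> R) :=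
  forall x y t, phi ((1 - t) *: x + t *: y) = (1 - t) * phi x + t * phi y.

Lemma affine_orient a b : affine_form (orient a b).
Proof. by move=> x y t; rewrite /orient !mxE; ring. Qed.

Lemma affine_formN phi : affine_form phi -> affine_form (fun x => - phi x).
Proof. by move=> h x y t; rewrite h; ring. Qed.

Lemma row2P (x y : 'rV[R]_2) : x 0 0 = y 0 0 -> x 0 1 = y 0 1 -> x = y.
Proof.
move=> h0 h1; apply/rowP => i; have [->//|] : i = 0 \/ i = 1.
  by case: i => [[|[|//]] ?]; [left|right]; apply/val_inj.
by move=> ->.
Qed.

Lemma orient_neq0 i j k : i != j -> i != k -> j != k ->
  orient (p i) (p j) (p k) != 0.
Proof.
move=> ij ik jk; apply/negP => /eqP o0; apply: (gp.2 _ _ _ ij ik jk).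
exists (p i), (p j - p i); split.
  by rewrite subr_eq0; apply: contra ij => /eqP/gp.1 ->.
suff [t kE] : exists t, p k = p i + t *: (p j - p i).
  move=> u [[]|] -> //=; [exists 0|exists 1|by exists t].
    by rewrite scale0r addr0.
  by rewrite scale1r addrC subrK.
move: o0; rewrite /orient => o0.
have [dx|dx] := eqVneq (p j 0 0 - p i 0 0) 0.
  have dy : p j 0 1 - p i 0 1 != 0.
    apply: contra ij => /eqP dy; apply/eqP/gp.1/row2P; apply/eqP.
      by rewrite eq_sym -subr_eq0 dx.
    by rewrite eq_sym -subr_eq0 dy.
  exists ((p k 0 1 - p i 0 1) / (p j 0 1 - p i 0 1)).
  apply: row2P; rewrite !mxE; last by field.
  move: o0; rewrite dx mul0r sub0r mulr0 addr0 => /eqP.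
  by rewrite oppr_eq0 mulf_eq0 (negbTE dy) orbF subr_eq0 => /eqP.
exists ((p k 0 0 - p i 0 0) / (p j 0 0 - p i 0 0)).
apply: row2P; rewrite !mxE; first by field.
apply: (mulfI dx); set d := p j 0 0 - p i 0 0 in dx o0 *.
transitivity (d * p i 0 1 + (p k 0 0 - p i 0 0) * (p j 0 1 - p i 0 1)); last by field.
lra.
Qed.

(** A point inside both segments would have [phi <= 0] from [e] and [phi > 0] from [f]. One strictly
    positive endpoint is enough because both weights are positive, so the segments may share an
    endpoint on the line [phi = 0]. *)
Lemma separated_nocross phi e f : affine_form phi ->
  (forall i, i \in e -> phi (p i) <= 0) ->
  (forall i, i \in f -> 0 <= phi (p i)) ->
  (exists2 i, i \in f & 0 < phi (p i)) -> ~ edges_cross p e f.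
Proof.
move=> aff he hf [k kf k0] [_ [x [[i [j [t [eE t0 t1 xE]]]]]]].
move=> [i' [j' [u [fE u0 u1 xE']]]].
have : phi x <= 0.
  rewrite xE aff; have := he i; have := he j; rewrite eE !inE !eqxx orbT /=.
  by move=> /(_ isT) ? /(_ isT) ?; nra.
have := hf i'; have := hf j'; rewrite fE !inE !eqxx orbT /=.
move=> /(_ isT) hj /(_ isT) hi.
suff : 0 < phi x by lra.
move: kf; rewrite xE' aff fE !inE => /orP[]/eqP ke; subst k; nra.
Qed.

Lemma edges_cross_sym e f : edges_cross p e f -> edges_cross p f e.
Proof. by rewrite /edges_cross eq_sym classical_sets.setIC. Qed.

(** The line carrying the first edge separates it from the second, whose other endpoint is off this
    line. *)
Lemma star_nocross a e f : e \in complete_edges V -> f \in complete_edges V ->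
  a \in e -> a \in f -> ~ edges_cross p e f.
Proof.
move=> eK fK /(edge_other eK)[i ai ->] /(edge_other fK)[j aj ->] cr.
have ij : i != j by apply/eqP => ij; case: cr; rewrite ij eqxx.
have [lt0|gt0|eq0] := ltrgtP (orient (p a) (p i) (p j)) 0; last first.
- by move: (orient_neq0 ai aj ij); rewrite eq0 eqxx.
- move: cr; apply: (separated_nocross (affine_orient (p a) (p i))).
  + by move=> k; rewrite !inE => /orP[]/eqP->; rewrite /orient; lra.
  + by move=> k; rewrite !inE => /orP[]/eqP->; rewrite ?(ltW gt0)// /orient; lra.
  + by exists j; rewrite // !inE eqxx orbT.
- move: cr; apply: (separated_nocross (affine_formN (affine_orient (p a) (p i)))).
  + by move=> k; rewrite !inE => /orP[]/eqP->; rewrite /orient; lra.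
  + by move=> k; rewrite !inE => /orP[]/eqP->; rewrite ?oppr_ge0 ?(ltW lt0)// /orient; lra.
  + by exists j; rewrite ?oppr_gt0 // !inE eqxx orbT.
Qed.

(* Counterclockwise orientation: the points of [A] lie to the left of [i j]. *)
Definition hull_edge A i j := i != j /\
  forall k, k \in A -> k != i -> k != j -> 0 < orient (p i) (p j) (p k).

Lemma hull_edge_nocross A i j e : hull_edge A i j -> e \in complete_edges V ->
  e \subset A -> ~ edges_cross p [set i; j]%SET e.
Proof.
move=> [ij h] eK eA cr; have ne : e != [set i; j]%SET by case: cr; rewrite eq_sym.
have [k ke kN] : exists2 k, k \in e & k \notin [set i; j]%SET.
  apply/subsetPn; apply: contra ne => sub.
  by rewrite eqEcard sub cards2 ij /=; move: eK; rewrite inE => /eqP ->.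
have {}h k' : k' \in e -> k' \notin [set i; j]%SET -> 0 < orient (p i) (p j) (p k').
  move=> k'e; rewrite !inE negb_or => /andP[ki kj].
  by apply: h => //; exact: (fintype.subsetP eA).
have hz k' : k' \in [set i; j]%SET -> orient (p i) (p j) (p k') = 0.
  by rewrite !inE => /orP[]/eqP->; rewrite /orient; ring.
apply: (separated_nocross (affine_orient (p i) (p j)) _ _ _ cr).
- by move=> k' /hz ->.
- move=> k' k'e; have [/hz->//|k'N] := boolP (k' \in [set i; j]%SET).
  exact/ltW/h.
- by exists k => //; exact: h.
Qed.

Definition plane_span A T :=
  [/\ T \subset complete_edges V, {in T, forall e, e \subset A}, plane_graph p T
    & {in A &, forall i j, connect (adjacent T) i j}].

Lemma plane_span_star A a : a \in A ->
  plane_span A [set [set a; i]%SET | i in A :\ a].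
Proof.
move=> aA; have hK e : e \in [set [set a; i]%SET | i in A :\ a] ->
    [/\ e \in complete_edges V, a \in e & e \subset A].
  move=> /imsetP[i /setD1P[ia iA] ->]; rewrite edge_set2 1?eq_sym //; split=> //.
    by rewrite !inE eqxx.
  by apply/fintype.subsetP => k; rewrite !inE => /orP[]/eqP->.
split.
- by apply/fintype.subsetP => e /hK[].
- by move=> e /hK[].
- move=> e f /hK[? ? _] /hK[? ? _]; exact: (star_nocross (a := a)).
- have ac i : i \in A -> connect (adjacent [set [set a; i]%SET | i in A :\ a]) a i.
    have [-> //|ia iA] := eqVneq i a; apply: connect_edge.
    by apply/imsetP; exists i => //; rewrite !inE ia.
  move=> i j iA jA; apply: (connect_trans _ (ac _ jA)).
  by rewrite connect_adjC ac.
Qed.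

Lemma plane_span_add A T x y : plane_span A T -> y \in A -> x != y ->
  {in T, forall e, ~ edges_cross p [set x; y]%SET e} ->
  plane_span (x |: A) ([set x; y]%SET |: T).
Proof.
move=> [TK TA Tp Tc] yA xy nc; split.
- by rewrite finset.subUset finset.sub1set TK andbT edge_set2.
- move=> e /setU1P[->|/TA eA].
    by apply/fintype.subsetP => k; rewrite !inE => /orP[]/eqP->; rewrite ?eqxx ?yA ?orbT.
  exact: fintype.subset_trans eA (finset.subsetUr _ _).
- move=> e f /setU1P[->|eT] /setU1P[->|fT].
  + by case; rewrite eqxx.
  + exact: nc.
  + by move=> /edges_cross_sym; exact: nc.
  + exact: Tp.
- have yc i : i \in x |: A -> connect (adjacent ([set x; y]%SET |: T)) y i.
    move=> /setU1P[->|iA].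
      by rewrite connect_adjC connect_edge // !inE eqxx.
    exact: (connect_adjS (finset.subsetUr _ _)) (Tc _ _ yA iA).
  move=> i j iA jA; apply: (connect_trans _ (yc _ jA)).
  by rewrite connect_adjC yc.
Qed.

End Geometry.

(** * Plane spanning graphs avoiding few edges *)

Section FewMissing.
Variables (R : realType) (V : finType) (p : V -> 'rV[R]_2).
Hypothesis gp : general_position p.
Implicit Types (e f : {set V}) (S T F : {set {set V}}) (A B : {set V}).

Definition sheared (t : R) (x : 'rV[R]_2) : R := x 0 0 + t * x 0 1.

Lemma affine_sheared t c : affine_form (fun x => sheared t x - c).
Proof. by move=> x y u; rewrite /sheared !mxE; ring. Qed.

(** Equal values at two points force [t] to be the ratio [bad] of this pair, and the chosen [t]
    exceeds all these ratios. Pairs with equal second coordinate, where [bad] is [0] by convention,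
    are treated apart. *)
Lemma sheared_injective : exists t, injective (fun i => sheared t (p i)).
Proof.
pose bad (x : V * V) := (p x.1 0 0 - p x.2 0 0) / (p x.2 0 1 - p x.1 0 1).
exists (1 + \sum_x `|bad x|) => i j ij; apply/eqP/negPn/negP => iNj.
have [y0|y0] := eqVneq (p j 0 1 - p i 0 1) 0.
  case/eqP: iNj; apply/gp.1/row2P; move: ij; rewrite /sheared; last by lra.
  by rewrite (_ : p j 0 1 = p i 0 1); lra.
have /eqP : bad (i, j) = 1 + \sum_x `|bad x|.
  apply: (mulIf y0); rewrite /bad /= divfK //; move: ij; rewrite /sheared.
  by lra.
rewrite lt_eqF // (le_lt_trans (ler_norm _)) //.
rewrite (bigD1 (i, j)) //= addrCA ltrDl ltr_pwDl ?ltr01 //.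
by rewrite sumr_ge0 // => x _.
Qed.

Section Sheared.
Variable t : R.
Hypothesis g_inj : injective (fun i => sheared t (p i)).
Local Notation g i := (sheared t (p i)).

(** Replacing the first coordinate by [sheared t] has determinant one, so it preserves
    orientations. *)
Lemma orient_sheared i j k : orient (p i) (p j) (p k) =
  (g j - g i) * (p k 0 1 - p i 0 1) - (g k - g i) * (p j 0 1 - p i 0 1).
Proof. by rewrite /orient /sheared; ring. Qed.

(** The segment from [A] to [B] that is lowest on the line [g = s] is the lower common tangent: a
    point below it would give a lower segment. *)
Lemma bridge A B (s : R) : A != finset.set0 -> B != finset.set0 ->
  {in A, forall a, g a < s} -> {in B, forall b, s < g b} ->
  exists a b, [/\ a \in A, b \in B & hull_edge p (A :|: B) a b].
Proof.
move=> /set0Pn[a0 a0A] /set0Pn[b0 b0B] As Bs.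
(* The height at which the line through a pair meets the line [g = s]. *)
pose I (x : V * V) := p x.1 0 1 + (s - g x.1) / (g x.2 - g x.1) * (p x.2 0 1 - p x.1 0 1).
have x0P : (a0, b0) \in finset.setX A B by rewrite in_setX a0A b0B.
case: (arg_minP (P := fun x => x \in setX A B) I x0P) => -[a b].
rewrite in_setX /= => /andP[aA bB] Imin.
have sa := As _ aA; have sb := Bs _ bB.
have ab : a != b by apply/negP => /eqP e; rewrite e in sa; lra.
exists a, b; split=> //; split=> // q qAB qa qb.
have o0 : orient (p a) (p b) (p q) != 0 by apply: orient_neq0; rewrite // eq_sym.
rewrite lt_def o0 /=; case/setUP: qAB => [qA|qB].
  have sq := As _ qA.
  (* Up to positive factors, the orientation is the change of height when [q] replaces [a]; for [q]
     in [B] it replaces [b]. *)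
  have := Imin (q, b); rewrite in_setX qA bB => /(_ isT).
  rewrite -subr_ge0 => I0; rewrite -(pmulr_lge0 _ (_ : 0 < g b - s)) ?subr_gt0 //.
  rewrite (_ : _ * _ = (g b - g a) * (g b - g q) * (I (q, b) - I (a, b))).
    by rewrite mulr_ge0 // mulr_ge0 // subr_ge0; lra.
  rewrite orient_sheared /I /=; field.
  by rewrite !subr_eq0 !gt_eqF //; lra.
have sq := Bs _ qB.
have := Imin (a, q); rewrite in_setX qB aA => /(_ isT).
rewrite -subr_ge0 => I0; rewrite -(pmulr_lge0 _ (_ : 0 < s - g a)) ?subr_gt0 //.
rewrite (_ : _ * _ = (g b - g a) * (g q - g a) * (I (a, q) - I (a, b))).
  by rewrite mulr_ge0 // mulr_ge0 // subr_ge0; lra.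
rewrite orient_sheared /I /=; field.
by rewrite !subr_eq0 !gt_eqF //; lra.
Qed.

(* An edge of the hull of [A :|: B] from [A] to [B] crosses nothing, so one of its
   endpoints can be removed and joined again by this edge. *)
Lemma bipartite_plane_span A B (s : R) : A != finset.set0 -> B != finset.set0 ->
  {in A, forall a, g a < s} -> {in B, forall b, s < g b} ->
  exists2 T, plane_span p (A :|: B) T &
    {in T, forall e, exists a b, [/\ a \in A, b \in B & e = [set a; b]%SET]}.
Proof.
have [n] := ubnP #|A|; elim: n A => // n IH A An A0 B0 As Bs.
have [/cards1P[a aE]|A1] := boolP (#|A| == 1%N).
  have aB : a \notin B.
    by apply/negP => /Bs; rewrite ltNge (ltW (As _ _)) // aE inE.
  exists [set [set a; i]%SET | i in (A :|: B) :\ a]%SET.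
    by apply: plane_span_star; rewrite // aE !inE eqxx.
  move=> e /imsetP[b]; rewrite aE !inE => /andP[/negbTE -> /= bB] ->.
  by exists a, b; rewrite !inE eqxx.
have [a [b [aA bB hab]]] := bridge A0 B0 As Bs.
have A'0 : A :\ a != finset.set0.
  rewrite -card_gt0; move: A1 An; rewrite (cardsD1 a) aA; case: #|_| => //.
have [|a' a'A|T Tsp TAB] := IH (A :\ a) _ A'0 B0 _ Bs.
- by move: An; rewrite (cardsD1 a A) aA.
- by apply: As; case/setD1P: a'A.
have [TK TA _ _] := Tsp.
exists ([set a; b]%SET |: T).
  rewrite -(setD1K aA) -finset.setUA; apply: plane_span_add => //.
  - by rewrite !inE bB orbT.
  - by case: hab.
  - move=> e eT; apply: (hull_edge_nocross hab); first exact: (fintype.subsetP TK).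
    by apply: fintype.subset_trans (TA _ eT) _; rewrite finset.setSU // subD1set.
move=> e /setU1P[->|/TAB[a' [b' [/setD1P[_ a'A] b'B ->]]]]; first by exists a, b.
by exists a', b'.
Qed.

(** The level line of the functional through [p s] separates the two graphs. By injectivity [s] is
    the only vertex on it, so every edge of [T'] reaches strictly beyond it. *)
Lemma plane_span_glue A B s T T' : s \in A -> s \in B ->
  {in A, forall a, g a <= g s} -> {in B, forall b, g s <= g b} ->
  plane_span p A T -> plane_span p B T' -> plane_span p (A :|: B) (T :|: T').
Proof.
move=> sA sB As Bs [TK TA Tp Tc] [T'K T'B T'p T'c]; split.
- by rewrite finset.subUset TK.
- move=> e /setUP[/TA|/T'B] eA; apply: (fintype.subset_trans eA).
    exact: finset.subsetUl.
  exact: finset.subsetUr.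
- have nc e f : e \in T -> f \in T' -> ~ edges_cross p e f.
    move=> eT fT; have fK := fintype.subsetP T'K _ fT.
    have fB := fintype.subsetP (T'B _ fT); have eA := fintype.subsetP (TA _ eT).
    apply: (separated_nocross (affine_sheared t (g s))).
    + by move=> i /eA/As; rewrite subr_le0.
    + by move=> i /fB/Bs; rewrite subr_ge0.
    + have [k kf ks] : exists2 k, k \in f & k != s.
        apply/exists_inP; apply: contraTT fK => /exists_inPn h.
        rewrite inE; suff : (#|f| < 2)%N by lia.
        rewrite ltnS -(cards1 s) subset_leq_card //; apply/fintype.subsetP => k.
        by move=> /h; rewrite negbK inE.
      exists k => //; rewrite subr_gt0 lt_neqAle (Bs _ (fB _ kf)) andbT.
      by apply: contra ks => /eqP /g_inj ->.
  move=> e f /setUP[eT|eT] /setUP[fT|fT]; [exact: Tp|exact: nc| |exact: T'p].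
  by move=> /edges_cross_sym; exact: nc.
- have sc i : i \in A :|: B -> connect (adjacent (T :|: T')) s i.
    move=> /setUP[iA|iB].
      exact: (connect_adjS (finset.subsetUl _ _)) (Tc _ _ sA iA).
    exact: (connect_adjS (finset.subsetUr _ _)) (T'c _ _ sB iB).
  move=> i j iA jA; apply: (connect_trans _ (sc _ jA)).
  by rewrite connect_adjC sc.
Qed.

End Sheared.

(** The bound is sharp, since one more missing edge can isolate a point. *)
Lemma few_missing_plane_span F A : F \subset complete_edges V -> A != set0 ->
  (#|A| == 1%N) || (#|[set e in F | e \subset A]|.+1 < #|A|)%N ->
  exists2 T, plane_span p A T & [disjoint T & F].
Proof.
move=> FK; have [t g_inj] := sheared_injective.
pose g i := sheared t (p i).
pose m A := #|[set e in F | e \subset A]|.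
have [n] := ubnP #|A|; elim: n A => // n IH A An A0.
have [/cards1P[a ->] _|A1 /= Am] := boolP (#|A| == 1%N).
  exists [set [set a; i]%SET | i in [set a] :\ a]%SET.
    by apply: plane_span_star => //; rewrite inE.
  by rewrite setDv imset0 disjoints_subset sub0set.
pose L s := [set i in A | g i <= g s].
pose U s := [set i in A | g s <= g i].
(* Take the last [s] such that the points up to [s] have too many missing edges for
   the induction hypothesis, and its successor [u].  If the points from [u] on have
   few missing edges, glue at [u]; otherwise the missing edges are all used up on
   the two sides, and none joins [L s] to [U u]. *)
pose heavy s := (#|L s| <= (m (L s)).+1)%N.
have [a aA a_heavy] : exists2 a, a \in A & heavy a.
  have /set0Pn[x xA] := A0.
  case: (arg_minP (P := fun x => x \in A) g xA) => a aA amin; exists a => //.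
  rewrite /heavy (_ : L a = [set a]); first by rewrite cards1.
  apply/setP => i; rewrite !inE; apply/andP/eqP => [[iA ia]|-> //].
  by apply/g_inj/le_anti; rewrite ia /= amin.
have aAh : (a \in A) && heavy a by rewrite aA.
case: (arg_maxP (P := fun x => (x \in A) && heavy x) g aAh) => s /andP[sA s_heavy] smax.
(* [A] itself is not heavy, so [s] is not its last point. *)
have [x xA sx] : exists2 x, x \in A & g s < g x.
  apply/exists_inP; apply: contraTT Am => /exists_inPn h.
  rewrite -leqNgt -/(m A); move: s_heavy; rewrite /heavy (_ : L s = A) //.
  apply/setP => i; rewrite inE; case: (boolP (i \in A)) => //= /h.
  by rewrite -leNgt.
have xAs : (x \in A) && (g s < g x) by rewrite xA.
case: (arg_minP (P := fun x => (x \in A) && (g s < g x)) g xAs) => u /andP[uA su] umin.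
have u_light : ~~ heavy u.
  apply/negP => uh; have : g u <= g s by apply: smax; rewrite uA uh.
  by rewrite leNgt su.
have LU : L s :|: U u = A.
  apply/setP => i; rewrite !inE -andb_orr; case: (boolP (i \in A)) => //= iA.
  by case: (leP (g i) (g s)) => //= si; rewrite umin // iA.
have LdU : [disjoint L s & U u].
  apply/pred0P => i; rewrite /= !inE; apply/negP.
  by move=> /andP[/andP[_ ?] /andP[_ ?]]; lra.
have Lu : L u = u |: L s.
  apply/setP => i; rewrite !inE; have [->|iu] /= := eqVneq i u; first by rewrite uA lexx.
  case: (boolP (i \in A)) => //= iA; apply/idP/idP => [iu'|]; last by lra.
  rewrite leNgt; apply/negP => si; case/eqP: iu; apply/g_inj/le_anti.
  by rewrite iu' /= umin // iA.
have cA : (#|L s| + #|U u|)%N = #|A| by rewrite -LU cardsU disjoint_setI0 // cards0 subn0.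
have cLu : #|L u| = #|L s|.+1 by rewrite Lu cardsU1 !inE leNgt su andbF.
have [U_light|U_heavy] := ltnP (m (U u)).+1 #|U u|.
  have [|||T Tsp TF] := IH (L u); first by clear - An cA cLu U_light; lia.
  - by apply/set0Pn; exists u; rewrite !inE uA lexx.
  - by rewrite -/(m _); move: u_light; rewrite /heavy -ltnNge => ->; rewrite orbT.
  have [|||T' T'sp T'F] := IH (U u).
  - have : (0 < #|L s|)%N by rewrite card_gt0; apply/set0Pn; exists s; rewrite !inE sA lexx.
    by clear - An cA; lia.
  - by apply/set0Pn; exists u; rewrite !inE uA lexx.
  - by rewrite -/(m _) U_light orbT.
  exists (T :|: T'); last first.
    rewrite disjoints_subset finset.subUset -!disjoints_subset; exact/andP.
  have -> : A = L u :|: U u.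
    by rewrite Lu -setUA LU; apply/esym/setUidPr; rewrite sub1set.
  apply: (plane_span_glue g_inj (s := u)) => //; rewrite ?inE ?uA ?lexx //.
    by move=> i; rewrite inE => /andP[].
  by move=> i; rewrite inE => /andP[].
have FLU : [set e in F | e \subset L s] :|: [set e in F | e \subset U u]
    = [set e in F | e \subset A].
  apply/eqP; rewrite eqEcard; apply/andP; split.
    apply/fintype.subsetP => e; rewrite !inE -LU => /orP[]/andP[-> /= eS].
      exact: fintype.subset_trans eS (finset.subsetUl _ _).
    exact: fintype.subset_trans eS (finset.subsetUr _ _).
  rewrite cardsU (_ : _ :&: _ = set0); last first.
    apply/setP => e; rewrite !inE; apply/negP => /andP[/andP[eF eL] /andP[_ eU]].
    have := fintype.subsetP FK _ eF; rewrite inE => /cards2P[i [j [_ eE]]].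
    have ie : i \in e by rewrite eE !inE eqxx.
    have := disjointFr LdU (fintype.subsetP eL _ ie).
    by rewrite (fintype.subsetP eU _ ie).
  move: s_heavy Am; rewrite cards0 subn0 /heavy -!/(m _).
  by clear - cA U_heavy; lia.
pose c := (g s + g u) / 2.
have [||||T Tsp TLU] := bipartite_plane_span (t := t) (A := L s) (B := U u) (s := c).
- by apply/set0Pn; exists s; rewrite !inE sA lexx.
- by apply/set0Pn; exists u; rewrite !inE uA lexx.
- by move=> i; rewrite inE -/(g i) /c => /andP[_ ?]; lra.
- by move=> i; rewrite inE -/(g i) /c => /andP[_ ?]; lra.
exists T; first by rewrite LU in Tsp.
apply/pred0P => e /=; apply/negP => /andP[/TLU[i [j [iL jU ->]]] eF].
have : [set i; j]%SET \in [set e in F | e \subset A].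
  rewrite inE eF /= -LU; apply/fintype.subsetP => k.
  by rewrite !inE => /orP[]/eqP->; [move: iL|move: jU]; rewrite inE => ->; rewrite ?orbT.
rewrite -FLU !inE eF /= => /orP[]/fintype.subsetP.
  by move=> /(_ j); rewrite (disjointFl LdU jU) !inE eqxx orbT => /(_ isT).
by move=> /(_ i); rewrite (disjointFr LdU iL) !inE eqxx => /(_ isT).
Qed.

End FewMissing.

(** * The hull cycle *)

Lemma continuous_affine2 (R : realType) (T : topologicalType) (u v : T -> R)
    (a b c d : R) :
  continuous u -> continuous v ->
  continuous (fun x => a * (v x - b) - (u x - c) * d).
Proof.
move=> cu cv x; apply: cvgB; apply: cvgM; try exact: cvg_cst.
  by apply: cvgB; [exact: cv|exact: cvg_cst].
by apply: cvgB; [exact: cu|exact: cvg_cst].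
Qed.

(** * Boundary and interior of the hull in terms of orientations *)

Section ConvexHull.
Variables (R : realType) (V : finType) (p : V -> 'rV[R]_2).
Hypothesis gp : general_position p.
Local Notation o i j k := (orient (p i) (p j) (p k)).
Local Notation hull := (convex_hull (range p)).

(** Convexity with unnormalised weights, so that areas can serve as weights. *)
Lemma convex_hull_weighted (A : set 'rV[R]_2) x y (a b : R) :
  convex_set (A : set (convex_lmodType 'rV[R]_2)) -> A x -> A y -> 0 < a -> 0 < b ->
  A ((a + b)^-1 *: (a *: x + b *: y)).
Proof.
move=> cA Ax Ay a0 b0; have ab0 : 0 < a + b by rewrite addr_gt0.
have t0 : 0 <= a / (a + b) by rewrite divr_ge0 ?ltW.
have t1 : a / (a + b) <= 1 by rewrite ler_pdivrMr // mul1r lerDl ltW.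
have := cA x y (Itv01 t0 t1) (mem_set Ax) (mem_set Ay) => /set_mem.
have tE : b / (a + b) = 1 - a / (a + b) by field; rewrite gt_eqF.
congr (A _); rewrite /conv /= scalerDr !scalerA.
by rewrite [_^-1 * a]mulrC [_^-1 * b]mulrC tE.
Qed.

Lemma sub_convex_hull i : hull (p i).
Proof. by apply: sub_gen_smallest; exists i. Qed.

(** The barycentric coordinates of [x] are proportional to the areas of the triangles that it spans
    with the three sides. *)
Lemma convex_hull_triangle i j k (x : 'rV[R]_2) :
  0 < orient (p i) (p j) x -> 0 < orient (p j) (p k) x ->
  0 < orient (p k) (p i) x -> hull x.
Proof.
set c := orient _ _ x; set a := orient (p j) _ _; set b := orient (p k) _ _.
move=> c0 a0 b0 A [cA pA].
have Ap l : A (p l) by apply: pA; exists l.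
have ab0 : 0 < a + b by rewrite addr_gt0.
have := convex_hull_weighted cA (convex_hull_weighted cA (Ap i) (Ap j) a0 b0) (Ap k) ab0 c0.
congr (A _); have abc0 : a + b + c != 0 by rewrite gt_eqF // addr_gt0.
rewrite [X in _ *: (X + _)]scalerA divff ?gt_eqF // scale1r.
apply: (scalerI abc0); rewrite scalerA divff // scale1r.
by apply: row2P; rewrite !mxE /a /b /c /orient; ring.
Qed.

Lemma orient_continuous (a b : 'rV[R]_2) : continuous (orient a b).
Proof.
by apply: (@continuous_affine2 R 'rV[R]_2 (fun x => x 0 0) (fun x => x 0 1));
  exact: coord_continuous.
Qed.

(** Lying strictly inside the triangle [j1 j2 j3] is an open condition. *)
Lemma convex_hull_interior i j1 j2 j3 :
  0 < o i j1 j2 -> 0 < o i j2 j3 -> 0 < o i j3 j1 -> interior hull (p i).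
Proof.
have cyc a b c : orient a b c = orient b c a :> R by rewrite /orient; ring.
rewrite ![orient (p i) _ _]cyc => h1 h2 h3.
have near_gt0 a b : 0 < orient a b (p i) -> \forall x \near p i, 0 < orient a b x.
  exact: (cvgr_gt _ (@orient_continuous a b (p i))).
rewrite /interior; near=> x; apply: (@convex_hull_triangle j1 j2 j3 x); near: x;
  exact: near_gt0.
Unshelve. all: by end_near. Qed.

(** Otherwise the hull lies on one side of the line through [p i] and [p v], while a small move from
    the interior point [p v] away from [p k] stays in the hull and leaves that side. *)
Lemma interior_not_extreme i v : ~ boundary hull (p v) ->
  ~ exists2 k, 0 < o i v k & forall l, 0 <= o i v l.
Proof.
move=> vb [k k0 vl].
have [hv|nv] := pselect (interior hull (p v)); last first.
  case: vb; split=> //.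
  by apply: topology_structure.subset_closure; exact: sub_convex_hull.
have hsub x : hull x -> 0 <= orient (p i) (p v) x.
  apply: (@smallest_sub _ _ _ [set y | 0 <= orient (p i) (p v) y]%classic).
    move=> y z t /set_mem /= y0 /set_mem /= z0; apply/mem_set.
    pose u := 1 - t%:num.
    have e : orient (p i) (p v) (t%:num *: (y : 'rV[R]_2) + u *: (z : 'rV[R]_2)) =
        t%:num * orient (p i) (p v) y + u * orient (p i) (p v) z.
      rewrite [X in X *: _ + _](_ : _ = 1 - u) ?affine_orient /u ?subKr //.
    suff : 0 <= orient (p i) (p v) (t%:num *: (y : 'rV[R]_2) + u *: (z : 'rV[R]_2)) by [].
    by rewrite e addr_ge0 // mulr_ge0 // subr_ge0.
  by move=> _ [j _ <-] /=.
have cl : ((p v - t *: (p k - p v)) @[t --> (0 : R)] --> p v - 0 *: (p k - p v))%classic.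
  by apply: cvgB; [exact: cvg_cst|apply: cvgZr_tmp; exact: cvg_id].
rewrite scale0r subr0 in cl.
have : \forall t \near ((0 : R)^'+)%classic, 0 < t /\ hull (p v - t *: (p k - p v)).
  near=> t; split; first by near: t; exact: nbhs_right_gt.
  by near: t; apply: cvg_at_right_filter cl _ hv.
move=> /filter_ex[t [t0 /hsub]].
rewrite (_ : _ - _ = (1 - - t) *: p v + (- t) *: p k); last first.
  by apply/rowP => j; rewrite !mxE; ring.
rewrite affine_orient (_ : orient (p i) (p v) (p v) = 0) ?mulr0 ?add0r; last first.
  by rewrite /orient; ring.
by rewrite nmulr_rge0 ?oppr_lt0 // leNgt k0.
Unshelve. all: by end_near. Qed.

End ConvexHull.

Section HullCycle.
Variables (R : realType) (V : finType) (p : V -> 'rV[R]_2).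
Hypothesis gp : general_position p.
Local Notation o i j k := (orient (p i) (p j) (p k)).
Local Notation hull := (convex_hull (range p)).

Lemma orient_cycle i j k : o i j k = o j k i.
Proof. by rewrite /orient; ring. Qed.

Lemma orient_swap i j k : o i k j = - o i j k.
Proof. by rewrite /orient; ring. Qed.

Lemma orient_id i j : o i j j = 0.
Proof. by rewrite /orient; ring. Qed.

Lemma orient_id1 i j : o i i j = 0.
Proof. by rewrite /orient; ring. Qed.

Lemma orient_id2 i j : o i j i = 0.
Proof. by rewrite /orient; ring. Qed.

Lemma orient_gt0_neq i j k : 0 < o i j k -> [/\ i != j, i != k & j != k].
Proof.
move=> o0; split; apply: contraTneq o0 => ->;
  by rewrite ?orient_id ?orient_id1 ?orient_id2 ltxx.
Qed.

Section Boundary.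
Variable i : V.
Hypothesis ib : boundary hull (p i).

(* A 3-cycle of this relation would put [p i] inside a triangle. *)
Lemma boundary_orient_trans a b c : 0 < o i a b -> 0 < o i b c -> 0 < o i a c.
Proof.
move=> ab bc; have [ia _ _] := orient_gt0_neq ab; have [_ ic _] := orient_gt0_neq bc.
have ac : a != c.
  by apply/eqP => ac; move: bc; rewrite -ac orient_swap; lra.
rewrite lt_def orient_neq0 //= leNgt; apply/negP => ca.
by apply: ib.2; apply: (convex_hull_interior ab bc); rewrite orient_swap oppr_gt0.
Qed.

(** By transitivity the other points are linearly ordered by angle around [p i]; the one with the
    most points to its left comes first. *)
Lemma hull_succ_exists x : x != i -> exists j, hull_edge p [set: V] i j.
Proof.
move=> xi; pose d j := #|[set k | 0 < o i j k]|.
case: (@arg_maxnP _ x (fun x => x != i) d xi) => j ji jmax.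
exists j; split=> [|k _ ki kj]; first by rewrite eq_sym.
rewrite lt_def orient_neq0 1?eq_sym //= leNgt; apply/negP => jk0.
have kj0 : 0 < o i k j by rewrite orient_swap oppr_gt0.
have := jmax _ ki; apply/negP; rewrite -ltnNge; apply: proper_card.
apply/properP; split.
  by apply/fintype.subsetP => l; rewrite !inE; exact: boundary_orient_trans kj0.
by exists j; rewrite inE // orient_id ltxx.
Qed.

End Boundary.

(** The interior point is made a fixed point so that the successor map is a permutation of all of
    [V]. *)
Lemma hull_cycle v : ~ boundary hull (p v) ->
  (forall i, i != v -> boundary hull (p i)) -> (3 <= #|V|)%N ->
  exists f : V -> V, [/\ injective f, f v = v,
    forall x, x != v -> hull_edge p [set: V] x (f x) &
    forall x y, x != v -> y != v -> fconnect f x y].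
Proof.
move=> vb hb V3.
have other (x : V) : exists y, y != x.
  have /card_gt0P[y] : (0 < #|[set~ x]|)%N by rewrite cardsC1; lia.
  by rewrite !inE; exists y.
have /choice[f0 f0P] x : exists y, x != v -> hull_edge p [set: V] x y.
  have [->|xv] := eqVneq x v; first by exists v.
  have [y yx] := other x; have [j hj] := hull_succ_exists (hb _ xv) yx.
  by exists j.
pose f x := if x == v then v else f0 x.
have fP x : x != v -> hull_edge p [set: V] x (f x).
  by move=> xv; rewrite /f (negbTE xv); exact: f0P.
have fv : f v = v by rewrite /f eqxx.
(* If [v] followed [x], all points would lie to the left of the line from [x] to [v], making [v]
   extreme. *)
have fNv x : x != v -> f x != v.
  move=> xv; apply/eqP => fxv; have [xfx fxo] := fP x xv.
  rewrite fxv in fxo; apply: (interior_not_extreme vb).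
  have /card_gt0P[y] : (0 < #|~: [set x; v]|)%N.
    by rewrite cardsCs setCK cards2 xv; lia.
  rewrite !inE negb_or => /andP[yx yv]; exists y; first exact: fxo.
  move=> l; have [->|lx] := eqVneq l x; first by rewrite orient_id2.
  have [->|lv] := eqVneq l v; first by rewrite orient_id.
  by rewrite ltW // fxo.
exists f; split=> //.
- move=> x y; have [->|xv] := eqVneq x v; have [-> //|yv] := eqVneq y v; rewrite ?fv.
  + by move/esym/eqP; rewrite (negbTE (fNv _ yv)).
  + by move/eqP; rewrite (negbTE (fNv _ xv)).
  move=> fxy; apply/eqP; apply: contraPT fxy => xy fxy.
  (* With a common successor, each of [x] and [y] would lie to the left of the edge leaving the
     other. *)
  have [xfx fxo] := fP x xv; have [yfy fyo] := fP y yv.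
  have h1 : 0 < o x (f x) y by apply: fxo; rewrite ?inE // ?fxy // eq_sym.
  have h2 : 0 < o y (f x) x by rewrite fxy; apply: fyo; rewrite ?inE // -fxy.
  by move: h1 h2; rewrite (orient_cycle x) (orient_cycle y) (orient_swap (f x) y x); lra.
- (* [orient (p y)] orders the hull vertices other than [y], and the successor map
     increases along this order until it reaches [y]. *)
  move=> x y xv yv; pose d x := #|[set k | 0 < o y x k]|.
  have [n] := ubnP (d x); elim: n x xv => // n IH x xv dn.
  have [-> //|xy] := eqVneq x y.
  have [fxy|fxy] := eqVneq (f x) y; first by rewrite -fxy fconnect1.
  apply: connect_trans (fconnect1 f x) _; apply: IH; first exact: fNv.
  move: dn; rewrite ltnS; apply: leq_trans; apply: proper_card.
  have yxfx : 0 < o y x (f x).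
    have [_ fxo] := fP x xv.
    by rewrite orient_cycle; apply: fxo; rewrite ?inE // eq_sym.
  apply/properP; split; last by exists (f x); rewrite inE // orient_id ltxx.
  apply/fintype.subsetP => l; rewrite !inE.
  exact: (boundary_orient_trans (hb _ yv) yxfx).
Qed.

End HullCycle.

(** * Exchanging edges of the same colour *)

(** The run begins at the first place after [a0] where [b] holds. Its length is [k.+1], so it is
    never empty. *)
Lemma first_run (b : pred nat) a0 l c0 : ~~ b a0 -> b l -> ~~ b c0 ->
  (a0 < l < c0)%N -> exists a k, [/\ (a0 <= a)%N, (a + k.+2 <= c0)%N, ~~ b a,
    forall i, (0 < i <= k.+1)%N -> b (a + i)%N & ~~ b (a + k.+2)%N].
Proof.
move=> ba0 bl bc0 /andP[a0l lc0].
have : exists i, (a0 < i)%N && b i by exists l; rewrite a0l.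
case/ex_minnP => i /andP[a0i bi] imin.
have : exists c, (i < c)%N && ~~ b c.
  by exists c0; rewrite bc0 andbT (leq_ltn_trans _ lc0) // imin ?a0l.
case/ex_minnP => c /andP[ic bc] cmin.
have cc0 : (c <= c0)%N by rewrite cmin // bc0 andbT (leq_ltn_trans _ lc0) // imin ?a0l.
have ec : (i.-1 + (c - i).-1.+2)%N = c by lia.
exists i.-1, (c - i).-1; rewrite ec; split=> //; first by lia.
- have [->//|ai] := eqVneq i.-1 a0; apply/negP => bi1.
  have : (i <= i.-1)%N by apply: imin; rewrite bi1 andbT; lia.
  by lia.
- move=> j jk; have [->|ji] := eqVneq (i.-1 + j)%N i; first by [].
  apply/negPn/negP => bj; have : (c <= i.-1 + j)%N by apply: cmin; rewrite bj andbT; lia.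
  by lia.
Qed.

Section OneInteriorPoint.
Variables (R : realType) (V : finType) (p : V -> 'rV[R]_2).
Hypothesis gp : general_position p.
Hypothesis V3 : (3 <= #|V|)%N.
Variables (v : V) (f : V -> V).
Hypothesis f_inj : injective f.
Hypothesis fv : f v = v.
Hypothesis f_hull : forall x, x != v -> hull_edge p [set: V] x (f x).
Hypothesis f_conn : forall x y, x != v -> y != v -> fconnect f x y.
Implicit Types (e : {set V}) (F T : {set {set V}}).

Let h x := [set x; f x]%SET.
(** Both the length of the hull cycle and the size of the forbidden sets. *)
Let m := #|V|.-1.

Lemma succ_neqv x : x != v -> f x != v.
Proof. by apply: contra => /eqP fx; apply/eqP/f_inj; rewrite fx fv. Qed.

Lemma iter_succ_neqv k x : x != v -> iter k f x != v.
Proof. by move=> xv; elim: k => //= k; exact: succ_neqv. Qed.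

Lemma succ_neq x : x != v -> x != f x.
Proof. by case/f_hull. Qed.

(** Otherwise [v] would lie to the left of the same edge in both directions. *)
Lemma succ2_neq x : x != v -> f (f x) != x.
Proof.
move=> xv; have fxv := succ_neqv xv; apply/eqP => ffx.
have [_ h1] := f_hull xv; have [_ h2] := f_hull fxv; rewrite ffx in h2.
have {}h1 : 0 < orient (p x) (p (f x)) (p v) by apply: h1; rewrite ?inE 1?eq_sym.
have {}h2 : 0 < orient (p (f x)) (p x) (p v) by apply: h2; rewrite ?inE 1?eq_sym.
by move: h1 h2; rewrite /orient; lra.
Qed.

Lemma hull_edge_inj x y : x != v -> h x = h y -> x = y.
Proof.
move=> xv hxy; have : x \in h y by rewrite -hxy !inE eqxx.
rewrite !inE => /orP[/eqP //|/eqP xfy].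
have : f x \in h y by rewrite -hxy !inE eqxx orbT.
rewrite !inE => /orP[/eqP fxy|/eqP /f_inj //].
by move: (succ2_neq xv); rewrite fxy -xfy eqxx.
Qed.

Lemma interior_notin_hull x : x != v -> v \notin h x.
Proof. by move=> xv; rewrite !inE negb_or eq_sym xv eq_sym succ_neqv. Qed.

Lemma hull_edge_complete x : x != v -> h x \in complete_edges V.
Proof. by move=> xv; apply: edge_set2; exact: succ_neq. Qed.

Lemma order_succ x : x != v -> fingraph.order f x = m.
Proof.
move=> xv; rewrite /fingraph.order /m -(cardsC1 v).
apply: eq_card => y; rewrite !inE; apply/idP/idP => [|yv]; last exact: f_conn.
by case/connectP => s /fpathP[k ->] ->; rewrite last_traject iter_succ_neqv.
Qed.

Lemma iter_order_succ x : x != v -> iter m f x = x.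
Proof. by move=> xv; rewrite -(order_succ xv) iter_order. Qed.

Lemma iter_succ_neq x i : x != v -> (0 < i < m)%N -> iter i f x != x.
Proof.
move=> xv /andP[i0 im]; apply/eqP => ix; have := @findex_iter _ f x i.
by rewrite order_succ // im ix findex0 => /(_ isT) i0'; rewrite -i0' in i0.
Qed.

Lemma iter_succP x y : x != v -> y != v -> exists2 i, (i < m)%N & iter i f x = y.
Proof.
move=> xv yv; exists (findex f x y); last by apply: iter_findex; exact: f_conn.
by rewrite -(order_succ xv) findex_max // f_conn.
Qed.

Lemma pred_exists x : x != v -> exists2 y, y != v & f y = x.
Proof.
move=> xv; exists (finv f x); last exact: f_finv.
by apply: contra xv => /eqP fx; rewrite -(f_finv f_inj x) fx fv.
Qed.

Lemma setC1P (x y : V) : reflect (x != y) (x \in [set~ y]).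
Proof. by rewrite !inE; exact: idP. Qed.

Lemma setU1_setC1 (x : V) : x |: [set~ x] = [set: V].
Proof. by apply/setP => y; rewrite !inE orbN. Qed.

Lemma hull_plane_span : plane_span p [set~ v] [set h x | x in [set~ v]].
Proof.
split.
- by apply/fintype.subsetP => e /imsetP[x /setC1P xv ->]; exact: hull_edge_complete.
- move=> e /imsetP[x]; rewrite !inE => xv ->.
  by apply/fintype.subsetP => y; rewrite !inE => /orP[]/eqP-> //; exact: succ_neqv.
- move=> e e' /imsetP[x /setC1P xv ->] /imsetP[y /setC1P yv ->].
  apply: (hull_edge_nocross (f_hull xv)); last exact: subsetT.
  exact: hull_edge_complete.
- move=> x y; rewrite !inE => xv yv; have [i _ <-] := iter_succP xv yv.
  elim: i => //= i IH; apply: connect_trans IH _; apply: connect_edge.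
  by apply/imsetP; exists (iter i f x); rewrite ?inE ?iter_succ_neqv.
Qed.

(* The admissible sets [F] of forbidden edges: the complements of the systems of
   representatives of the colours, under the assumption that the theorem fails. *)
Variable valid : {set {set V}} -> Prop.
Hypothesis validK : forall F, valid F -> F \subset complete_edges V.
Hypothesis valid_card : forall F, valid F -> #|F| = m.
Hypothesis valid_blocks : forall F T, valid F ->
  plane_span p [set: V] T -> ~~ [disjoint T & F].
Hypothesis valid_swap : forall F e, valid F -> e \in F ->
  exists2 r, r \notin F & valid (r |: F :\ e).

Lemma valid_blocksP F T : valid F -> plane_span p [set: V] T ->
  exists2 e, e \in T & e \in F.
Proof. by move=> Fv /(valid_blocks Fv)/pred0Pn[e /andP[]]; exists e. Qed.

Lemma valid_cover F x : valid F -> exists2 e, e \in F & x \in e.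
Proof.
move=> Fv; have [e /imsetP[y _ ->] eF] := valid_blocksP Fv
  (plane_span_star gp (in_setT x)).
by exists [set x; y]%SET; rewrite // !inE eqxx.
Qed.

(** A second edge of [F] at [f x] leaves at most [m - 2] forbidden edges among the [m] other points.
    These then have a plane connected graph avoiding [F], to which the uncrossed edge [h x] attaches
    [f x]. *)
Lemma valid_leaf F x e : valid F -> x != v -> h x \notin F -> h (f x) \in F ->
  e \in F -> f x \in e -> e = h (f x).
Proof.
move=> Fv xv hx hfx eF fxe; apply/eqP/negPn/negP => eN.
have [T Tsp TF] : exists2 T, plane_span p [set~ f x] T & [disjoint T & F].
  apply: few_missing_plane_span => //; first exact: validK.
    by rewrite -card_gt0 cardsC1; lia.
  apply/orP; right; rewrite cardsC1 -/m -(valid_card Fv).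
  rewrite (cardsD1 (h (f x)) F) hfx (cardsD1 e (_ :\ _)) !inE eN eF /= !add1n !ltnS.
  apply: subset_leq_card; apply/fintype.subsetP => e'; rewrite !inE.
  move=> /andP[-> e'x]; rewrite andbT; apply/andP; split.
    by apply: contraTneq e'x => ->; apply/subsetPn; exists (f x); rewrite // !inE negbK.
  by apply: contraTneq e'x => ->; apply/subsetPn; exists (f x); rewrite !inE ?eqxx.
have [TK TA _ _] := Tsp.
have /(valid_blocksP Fv)[e' /setU1P[->|e'T]] :
    plane_span p [set: V] ([set f x; x]%SET |: T).
- rewrite -(setU1_setC1 (f x)); apply: plane_span_add => //.
  + by rewrite !inE succ_neq.
  + by rewrite eq_sym succ_neq.
  + move=> e' e'T; rewrite setUC; apply: (hull_edge_nocross (f_hull xv)).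
      exact: (fintype.subsetP TK).
    exact: subsetT.
- by rewrite setUC => hx'; case/negP: hx.
- by move=> e'F; have := disjointFr TF e'T; rewrite e'F.
Qed.

(** By [valid_leaf], [h (f x)] is the only edge of [F] at [f x]. So the star at [f x] without this
    edge, completed by the next hull edge, avoids [F]. *)
Lemma valid_no_isolated_edge F x : valid F -> x != v -> h x \notin F ->
  h (f x) \in F -> h (f (f x)) \notin F -> False.
Proof.
move=> Fv xv hx hfx hffx; have fxv := succ_neqv xv; have ffxv := succ_neqv fxv.
have fxA : f x \in [set~ f (f x)] by rewrite !inE succ_neq.
have Tsp := plane_span_star gp fxA; have [TK _ _ _] := Tsp.
have /(valid_blocksP Fv)[e /setU1P[->|]] :
    plane_span p [set: V] (h (f (f x)) |: [set [set f x; i]%SET | i in [set~ f (f x)] :\ f x]).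
- rewrite -(setU1_setC1 (f (f x))); apply: plane_span_add => //.
  + by rewrite !inE eq_sym succ_neq.
  + exact: succ_neq.
  + move=> e eT; apply: (hull_edge_nocross (f_hull ffxv)); last exact: subsetT.
    exact: (fintype.subsetP TK).
- by rewrite (negbTE hffx).
- move=> /imsetP[y /setD1P[yfx /setC1P yffx] ->] yF.
  have fxe : f x \in [set f x; y]%SET by rewrite !inE eqxx.
  have := valid_leaf Fv xv hx hfx yF fxe.
  by rewrite eq_sym in yfx => /(set2_inj yfx)/eqP; rewrite (negbTE yffx).
Qed.

(** If [F] has no hull edge, the hull cycle with any one spoke at [v] spans, so every spoke is in
    [F] and by counting [F] is the set of spokes. After exchanging a spoke, the new edge is a hull
    edge, and it is isolated. *)
Lemma valid_hull_edge F : valid F -> exists2 x, x != v & h x \in F.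
Proof.
have star G : valid G -> {in [set~ v], forall x, h x \notin G} ->
    {in [set~ v], forall w, [set v; w]%SET \in G}.
  move=> Gv noh w /setC1P wv; have [TK TA _ _] := hull_plane_span.
  have /(valid_blocksP Gv)[e /setU1P[->//|/imsetP[x xv ->]]] :
      plane_span p [set: V] ([set v; w]%SET |: [set h x | x in [set~ v]]).
    rewrite -(setU1_setC1 v); apply: plane_span_add; first exact: hull_plane_span.
    - exact/setC1P.
    - by rewrite eq_sym.
    - move=> e /imsetP[x /setC1P xv ->] /edges_cross_sym.
      apply: (hull_edge_nocross (f_hull xv)); last exact: subsetT.
      by apply: edge_set2; rewrite eq_sym.
  by rewrite (negbTE (noh _ xv)).
move=> Fv; have [/exists_inP[x /setC1P xv hx]|/exists_inPn noh] :=
  boolP [exists x in [set~ v], h x \in F]; first by exists x.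
have FE : F = [set [set v; w]%SET | w in [set~ v]].
  apply/esym/eqP; rewrite eqEcard; apply/andP; split.
    by apply/fintype.subsetP => e /imsetP[w wv ->]; exact: star.
  rewrite card_in_imset ?cardsC1 ?valid_card // => w w' /setC1P wv _.
  by rewrite eq_sym in wv; exact: set2_inj.
have /card_gt0P[w wv] : (0 < #|[set~ v]|)%N by rewrite cardsC1; lia.
have vwF : [set v; w]%SET \in F by exact: star.
have [r rF F'v] := valid_swap Fv vwF.
(* Without a hull edge in the new set, all spokes would be in it, so [r] would be the removed
   spoke. *)
have [/exists_inP[x xv hx]|/exists_inPn noh'] :=
    boolP [exists x in [set~ v], h x \in r |: F :\ [set v; w]%SET]; last first.
  have := star _ F'v noh' _ wv; rewrite !inE eqxx /= orbF => /eqP rE.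
  by rewrite -rE vwF in rF.
have h'E y : y \in [set~ v] -> h y \in r |: F :\ [set v; w]%SET -> h y = r.
  by move=> yv /setU1P[//|/setD1P[_]]; rewrite (negbTE (noh _ yv)).
have h'N y : y != v -> y != x -> h y \notin r |: F :\ [set v; w]%SET.
  move=> yv yx; apply: contra yx => /(h'E _ (introT (setC1P _ _) yv)).
  by rewrite -(h'E _ xv hx) => /(hull_edge_inj yv) ->.
have {}xv := elimT (setC1P _ _) xv; have [y yv fy] := pred_exists xv.
case: (@valid_no_isolated_edge _ y F'v yv); rewrite ?fy //.
  by apply: h'N => //; rewrite -fy succ_neq.
by apply: h'N; rewrite ?succ_neqv // eq_sym succ_neq.
Qed.

(** Otherwise, by counting, [F] is the hull cycle, which does not cover [v]. *)
Lemma valid_hull_gap F : valid F -> exists2 x, x != v & h x \notin F.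
Proof.
move=> Fv; have [/exists_inP[x /setC1P xv hx]|/exists_inPn allh] :=
  boolP [exists x in [set~ v], h x \notin F]; first by exists x.
have FE : F = [set h x | x in [set~ v]].
  apply/esym/eqP; rewrite eqEcard; apply/andP; split.
    by apply/fintype.subsetP => e /imsetP[w /allh]; rewrite negbK => ? ->.
  rewrite card_in_imset ?cardsC1 ?valid_card // => x y /setC1P xv _.
  exact: hull_edge_inj.
have [e] := valid_cover v Fv; rewrite FE => /imsetP[x /setC1P xv ->].
by rewrite (negbTE (interior_notin_hull xv)).
Qed.

(** Exchanging the first edge of the run shortens it. The bound [k.+2 < m] says that the gaps before
    and after the run are different hull edges. *)
Lemma valid_no_run k F x : valid F -> x != v -> h x \notin F ->
  (forall i, (0 < i <= k.+1)%N -> h (iter i f x) \in F) ->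
  h (iter k.+2 f x) \notin F -> (k.+2 < m)%N -> False.
Proof.
elim: k F x => [|k IH] F x Fv xv hx hrun hend km.
  exact: (valid_no_isolated_edge Fv xv hx (hrun 1%N isT) hend).
have fxv := succ_neqv xv; have hfx := hrun 1%N isT.
have [r rF F'v] := valid_swap Fv hfx.
(* The removed edge was the only one at [f x], so [r] has to cover [f x]; hence it cannot fill the
   gap after the run. *)
have fxr : f x \in r.
  have [e /setU1P[->//|/setD1P[eN eF]] fxe] := valid_cover (f x) F'v.
  by rewrite (valid_leaf Fv xv hx hfx eF fxe) eqxx in eN.
apply: (IH _ (f x) F'v fxv); last by lia.
- by rewrite !inE eqxx orbF; apply: contraNneq rF => <-.
- move=> i /andP[i0 ik]; rewrite !inE -iterSr hrun ?andbT; last by lia.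
  apply/orP; right; apply/negP => /eqP/(hull_edge_inj (iter_succ_neqv i.+1 xv)).
  by rewrite iterSr => /eqP; rewrite (negbTE (iter_succ_neq fxv _)) //; lia.
- rewrite !inE negb_or -iterSr (negbTE hend) andbF andbT.
  apply: contraTneq fxr => <-; rewrite !inE negb_or iterSr -iterS.
  by apply/andP; split; rewrite eq_sym iter_succ_neq //; lia.
Qed.

Lemma valid_one_gap F x y : valid F -> x != v -> h x \notin F ->
  y != v -> y != x -> h y \in F.
Proof.
move=> Fv xv hx yv yx; apply/negPn/negP => hy.
have [z zv hz] := valid_hull_edge Fv.
have [j jm jy] := iter_succP xv yv; have [l lm lz] := iter_succP xv zv.
pose b i := h (iter i f x) \in F.
have b0 : ~~ b 0%N by [].
have bm : ~~ b m by rewrite /b iter_order_succ.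
have bj : ~~ b j by rewrite /b jy.
have bl : b l by rewrite /b lz.
have j0 : (0 < j)%N by rewrite lt0n; apply: contra yx => /eqP j0; rewrite -jy j0.
have jl : j != l by apply: contraTneq bl => <-.
have l0 : (0 < l)%N by rewrite lt0n; apply: contraTneq bl => ->.
(* Unrolled from [x], the cycle has gaps at [0], [j] and [m]. The edge at [l] lies between two
   consecutive ones of these, so its run and both gaps take fewer than [m] steps. *)
have [a [k [akm ba brun bend]]] : exists a k, [/\ (k.+2 < m)%N, ~~ b a,
    forall i, (0 < i <= k.+1)%N -> b (a + i)%N & ~~ b (a + k.+2)%N].
  have [lj|jl'] := ltnP l j.
    have /(first_run b0 bl bj)[a [k [_ akj ? ? ?]]] : (0 < l < j)%N by rewrite l0.
    exists a, k; split=> //; exact: leq_ltn_trans (leq_trans (leq_addl _ _) akj) jm.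
  have /(first_run bj bl bm)[a [k [ja akm ? ? ?]]] : (j < l < m)%N by rewrite lm andbT ltn_neqAle jl.
  exists a, k; split=> //; apply: leq_trans akm.
  by rewrite -[ltnLHS]add0n ltn_add2r (leq_trans j0).
apply: (@valid_no_run k F (iter a f x)) => //; first exact: iter_succ_neqv.
  by move=> i /brun; rewrite /b addnC iterD.
by move: bend; rewrite /b addnC iterD.
Qed.

Lemma no_valid F : ~ valid F.
Proof.
move=> Fv; have [x xv hx] := valid_hull_gap Fv.
have [g gF vg] := valid_cover v Fv.
have [w vw gE] := edge_other (fintype.subsetP (validK Fv) _ gF) vg.
have wv : w != v by rewrite eq_sym.
have [y yv fy] := pred_exists wv.
have [k _ ky] := iter_succP xv yv.
(* Exchanging the hull edge after the gap makes that edge the new gap, while [g], which contains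
   [v], is never exchanged. The gap can thus be moved just before [w]. *)
have [G [Gv hy gG]] : exists G, [/\ valid G, h y \notin G & g \in G].
  rewrite -ky {ky}; elim: k => [|k [G [Gv hk gG]]]; first by exists F.
  have kv := iter_succ_neqv k xv; have kv' := succ_neqv kv.
  have hk' : h (f (iter k f x)) \in G.
    by apply: (valid_one_gap Gv kv hk kv'); rewrite eq_sym succ_neq.
  have [r rG G'v] := valid_swap Gv hk'.
  exists (r |: G :\ h (f (iter k f x))); split=> //.
    by rewrite !inE eqxx orbF; apply: contraNneq rG => <-.
  rewrite !inE gG andbT; apply/orP; right.
  by apply: contraNneq (interior_notin_hull kv') => <-.
have hw : h w \in G by apply: (valid_one_gap Gv yv hy wv); rewrite -fy eq_sym succ_neq.
have gw : g = h w.
  by rewrite -fy; apply: (valid_leaf Gv yv hy _ gG); rewrite fy // gE !inE eqxx orbT.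
by move: vg; rewrite gw (negbTE (interior_notin_hull wv)).
Qed.

End OneInteriorPoint.

(** * Choosing one edge of each colour *)

Lemma imset_transversal (T C : finType) (c : T -> C) (A : {set T}) :
  exists D : {set T}, [/\ D \subset A, {in D &, injective c} & c @: D = c @: A].
Proof.
pose rep x := odflt x [pick y in A | c y == c x].
have repP x : x \in A -> rep x \in A /\ c (rep x) = c x.
  move=> xA; rewrite /rep; case: pickP => [y /andP[yA /eqP]|/(_ x)]; rewrite /= ?xA ?eqxx //.
exists (rep @: A); split.
- by apply/fintype.subsetP => _ /imsetP[x /repP[xA _] ->].
- move=> _ _ /imsetP[x xA ->] /imsetP[y yA ->].
  have [[_ ->] [_ ->]] := (repP x xA, repP y yA); rewrite /rep => xy.
  rewrite (eq_pick (Q := [pred z in A | c z == c y])); last by move=> z /=; rewrite xy.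
  by case: pickP => // /(_ y); rewrite /= yA eqxx.
- apply/setP => d; apply/imsetP/imsetP => [[_ /imsetP[x xA ->] ->]|[x xA ->]].
    by exists x => //; have [] := repP x xA.
  by exists (rep x); [exact: imset_f|have [] := repP x xA].
Qed.

Lemma card_complete_edges (V : finType) : #|complete_edges V| = 'C(#|V|, 2).
Proof. exact: card_draws. Qed.

Section Transversal.
Variables (V C : finType) (c : {set V} -> C).
Implicit Types (e : {set V}) (F : {set {set V}}).
Hypothesis V3 : (3 <= #|V|)%N.
Hypothesis hc : #|c @: complete_edges V| = ('C(#|V|, 2) - #|V| + 1)%N.

(** The size condition leaves as many edges outside [F] as there are colours, so by injectivity each
    colour occurs there exactly once. *)
Definition cotransversal F := [/\ F \subset complete_edges V,
  {in complete_edges V :\: F &, injective c} & #|F| = #|V|.-1].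

(** This keeps the subtraction of natural numbers in the number of colours from being truncated. *)
Lemma leq_bin2 n : (3 <= n -> n <= 'C(n, 2))%N.
Proof.
by case: n => [|[|[|n]]] // _; rewrite binS bin1 -[X in (X <= _)%N]add1n leq_add2r bin_gt0.
Qed.

Lemma cotransversal_exists : exists F, cotransversal F.
Proof.
have [D [DK Dinj cD]] := imset_transversal c (complete_edges V).
have cardD : #|D| = ('C(#|V|, 2) - #|V| + 1)%N by rewrite -hc -cD card_in_imset.
exists (complete_edges V :\: D); split; first exact: subsetDl.
  by rewrite setDDr setDv set0U (setIidPr DK).
rewrite cardsD (setIidPr DK) card_complete_edges cardD.
by have := leq_bin2 V3; lia.
Qed.

(** The edge [r] is the chosen representative of the colour of [e]. *)
Lemma cotransversal_swap F e : cotransversal F -> e \in F ->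
  exists2 r, r \notin F & cotransversal (r |: F :\ e).
Proof.
move=> [FK Finj cardF] eF; have eK := fintype.subsetP FK _ eF.
have /imsetP[r /setDP[rK rF] cer] : c e \in c @: (complete_edges V :\: F).
  suff -> : c @: (complete_edges V :\: F) = c @: complete_edges V by exact: imset_f.
  apply/eqP; rewrite eqEcard imsetS ?subsetDl //= hc card_in_imset //.
  by rewrite cardsD (setIidPr FK) card_complete_edges cardF; have := leq_bin2 V3; lia.
exists r => //; split.
- by rewrite finset.subUset finset.sub1set rK; apply: fintype.subset_trans FK; exact: subD1set.
- have cases x : x \in complete_edges V :\: (r |: F :\ e) ->
      x = e \/ x \in complete_edges V :\: F /\ x != r.
    rewrite in_setD in_setU1 in_setD1 in_setD negb_or negb_and negbK.
    by move=> /andP[/andP[-> /orP[/eqP|->]] ->]; [left|right].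
  move=> x y /cases[->|[xF xr]] /cases[->|[yF yr]] // cxy; last exact: Finj.
    case/eqP: yr; apply: Finj => //; last by rewrite -cer.
    by rewrite in_setD rF.
  case/eqP: xr; apply: Finj => //; last by rewrite -cer.
  by rewrite in_setD rF.
- by rewrite cardsU1 in_setD1 (negbTE rF) andbF -cardF [in RHS](cardsD1 e F) eF.
Qed.

End Transversal.

Theorem theorem4 (R : realType) (n : nat) (p : 'I_n -> 'rV[R]_2)
    (C : finType) (c : {set 'I_n} -> C)
    (hn : (3 <= n)%N)
    (hp : general_position p)
    (hin : exists! v : 'I_n, ~ boundary (convex_hull (range p)) (p v))
    (hc : #|(c @: complete_edges 'I_n)%SET| = ('C(n, 2) - n + 1)%N) :
  exists T : {set {set 'I_n}},
    [/\ spanning_tree T, plane_graph p T & heterochromatic c T].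
Proof.
have V3 : (3 <= #|'I_n|)%N by rewrite card_ord.
have [v [vb vuniq]] := hin.
have hb i : i != v -> boundary (convex_hull (range p)) (p i).
  by move=> iv; apply: contrapT => /vuniq vi; rewrite vi eqxx in iv.
have [f [f_inj fv f_hull f_conn]] := hull_cycle hp vb hb V3.
have hc' : #|(c @: complete_edges 'I_n)%SET| = ('C(#|'I_n|, 2) - #|'I_n| + 1)%N.
  by rewrite card_ord.
apply: contrapT => noT.
(* Outside [F] all colours are distinct, so a plane connected graph avoiding [F] would contain the
   desired tree. *)
have blocks F T : cotransversal c F -> plane_span p [set: 'I_n] T ->
    ~~ [disjoint T & F].
  move=> [_ Finj _] [TK _ Tp Tc]; apply/negP => TF; apply: noT.
  have Tconn : connected_graph T by move=> i j; apply: Tc; rewrite inE.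
  have [T' T'T T'tree] := connected_spanning_tree TK Tconn.
  have T'D e : e \in T' -> e \in complete_edges 'I_n :\: F.
    move=> /(fintype.subsetP T'T) eT.
    by rewrite in_setD (disjointFr TF eT) (fintype.subsetP TK).
  exists T'; split=> //.
    by move=> e e' eT e'T; apply: Tp; exact: (fintype.subsetP T'T).
  by move=> e e' /T'D eD /T'D e'D; exact: Finj.
have [F Fv] := cotransversal_exists V3 hc'.
apply: (no_valid hp V3 f_inj fv f_hull f_conn _ _ blocks _ Fv).
- by move=> G [].
- by move=> G [].
- by move=> G e; exact: cotransversal_swap.
Qed.
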